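(* For all integers $r\ge1$ and $\delta\ge1$ there exists an $r$-uniform hypergraph $H$ with $\delta^*(H)=\delta$ such that, as $n\to\infty$, \[\mathrm{wsat}(n,H)\le \left(\frac{\delta}{r}-\frac{1}{\binom{r+\delta-1}{r-1}}\right)\binom{n}{r-1}+o(n^{r-1}).\]
   Context: An $r$-uniform hypergraph $H$ has a finite vertex set $V(H)$ and edge set $E(H)\subseteq\binom{V(H)}{r}$ (where $\binom{T}{k}$ is the set of $k$-element subsets of $T$); $H$ is non-empty if $|E(H)|\ge1$. $K_n^r$ denotes the complete $r$-uniform hypergraph on $n$ vertices. For a non-empty $r$-uniform $H$, an $r$-uniform hypergraph $F$ on $n$ vertices is weakly $H$-saturated if the edges of $E(K_n^r)\setminus E(F)$ can be ordered $e_1,\dots,e_k$ so that for each $i$, the hypergraph $F\cup\{e_1,\dots,e_i\}$ contains a copy of $H$ (a subhypergraph isomorphic to $H$) that contains the edge $e_i$. $\mathrm{wsat}(n,H)$ is the minimum number of edges of a weakly $H$-saturated $r$-uniform hypergraph on $n$ vertices. For $U\subseteq V(H)$ the link is $L_H(U)=\{e\setminus U : e\in E(H),\ U\subseteq e\}$. For non-empty $H$, $\delta^*(H)=\min\{|L_H(U)| : U\in\binom{V(H)}{r-1},\ |L_H(U)|\neq0\}$; for empty $H$, $\delta^*(H)=0$. *)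

(* Defs.v *)
From mathcomp Require Import all_boot.

Set Implicit Arguments.
Unset Strict Implicit.
Unset Printing Implicit Defensive.

(* A hypergraph on the finite vertex type T is given by its set of edges, of  *)
(* type {set {set T}}; vertices that lie in no edge are allowed.              *)

Section Hypergraph.
Variables (T : finType) (r : nat).
Implicit Types (H F : {set {set T}}) (U : {set T}).

Definition complete : {set {set T}} := [set e : {set T} | #|e| == r].

Definition uniform H : bool := H \subset complete.

Definition link H U : {set {set T}} := [set e :\: U | e : {set T} in H & U \subset e].

(* The default value #|H| of the iterated minimum bounds every #|link H U|,   *)
(* so it only matters if no U qualifies; for r > 0 and H uniform this means   *)
(* that H is empty, and the value is then 0. See delta_starP, delta_star0.    *)
Definition delta_star H : nat :=
  \big[minn/#|H|]_(U : {set T} | (#|U| == r.-1) && (#|link H U| != 0)) #|link H U|.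

End Hypergraph.

Arguments complete T r : clear implicits.

(* f ranges over all injections of the vertex set of H, so that a copy of H   *)
(* includes its isolated vertices.                                            *)
Definition has_copy_through (V T : finType) (H : {set {set V}})
    (G : {set {set T}}) (e : {set T}) : bool :=
  [exists f : {ffun V -> T},
     let fH := [set f @: (x : {set V}) | x in H] in
     [&& injectiveb f, fH \subset G & e \in fH]].

Definition weakly_saturated (V T : finType) (r : nat) (H : {set {set V}})
    (F : {set {set T}}) : bool :=
  uniform r F &&
  has (fun s => [forall i : 'I_(size s),
         has_copy_through H (F :|: [set:: take i.+1 s]) (nth set0 s i)])
      (permutations (enum (complete T r :\: F))).

Definition wsat (r n : nat) (V : finType) (H : {set {set V}}) : nat :=
  #|[arg min_(F < complete 'I_n r | weakly_saturated r H F) #|F|]|.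

Lemma card_link_le (T : finType) (H : {set {set T}}) (U : {set T}) :
  #|link H U| <= #|H|.
Proof.
apply: leq_trans (leq_imset_card _ _) _.
by apply/subset_leq_card/subsetP => e; rewrite inE => /andP[].
Qed.

Lemma delta_star0 (T : finType) (r : nat) : delta_star r (set0 : {set {set T}}) = 0.
Proof.
rewrite /delta_star big_pred0 ?cards0 // => U.
by move: (card_link_le set0 U); rewrite cards0 leqn0 => /eqP->; rewrite andbF.
Qed.

Lemma delta_starP (T : finType) (r : nat) (H : {set {set T}}) :
  0 < r -> uniform r H -> H != set0 ->
  (exists U : {set T}, [/\ #|U| = r.-1, #|link H U| != 0 &
                           delta_star r H = #|link H U|]) /\
  (forall U : {set T}, #|U| = r.-1 -> #|link H U| != 0 ->
                       delta_star r H <= #|link H U|).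
Proof.
move=> r_gt0 /subsetP unifH /set0Pn[e eH].
pose P (U : {set T}) := (#|U| == r.-1) && (#|link H U| != 0).
have [U0 PU0] : exists U, P U.
  have /set0Pn[x xe] : e != set0.
    by move: (unifH e eH); rewrite inE -card_gt0 => /eqP->.
  exists (e :\ x); apply/andP; split.
    by move: (unifH e eH); rewrite inE (cardsD1 x) xe => /eqP<-.
  rewrite -lt0n card_gt0; apply/set0Pn; exists (e :\: (e :\ x)).
  by apply: imset_f; rewrite inE eH subD1set.
have le_delta U : P U -> delta_star r H <= #|link H U|.
  rewrite /delta_star -/(P _) => PU.
  have : U \in index_enum _ by rewrite mem_index_enum.
  elim: (index_enum _) => // W s IHs; rewrite inE big_cons.
  case/predU1P => [<-|Us]; first by rewrite -/(P U) PU geq_minl.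
  by case: ifP => _; [apply: leq_trans (geq_minr _ _) _|]; apply: IHs.
split=> [|U cU lU]; last by apply: le_delta; rewrite /P cU eqxx.
case: (arg_minnP (fun U => #|link H U|) PU0) => U PU minU.
exists U; move: (PU) => /andP[/eqP cU lU]; split=> //.
apply/eqP; rewrite eqn_leq le_delta //= /delta_star.
elim/big_ind: _ => [|x y hx hy|W PW]; first exact: card_link_le.
  by rewrite leq_min hx.
exact: minU.
Qed.

Lemma complete_weakly_saturated (V T : finType) (r : nat) (H : {set {set V}}) :
  weakly_saturated r H (complete T r).
Proof.
rewrite /weakly_saturated /uniform subxx setDv enum_set0 andTb.
apply/hasP; exists [::]; first by rewrite mem_permutations.
by apply/forallP => -[].
Qed.

Lemma wsatP (r n : nat) (V : finType) (H : {set {set V}}) :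
  (exists2 F : {set {set 'I_n}}, weakly_saturated r H F & wsat r n H = #|F|) /\
  (forall F : {set {set 'I_n}}, weakly_saturated r H F -> wsat r n H <= #|F|).
Proof.
rewrite /wsat; case: arg_minnP => [|F wF minF].
  exact: complete_weakly_saturated.
by split; first by exists F.
Qed.

(* Main.v *)
Require Import Defs.
From mathcomp Require Import all_boot all_order all_algebra zify ring.
Set Implicit Arguments.
Unset Strict Implicit.
Unset Printing Implicit Defensive.

(** Put [t = r - 1] and [k = r + delta - 1], and take [k]-subsets of the
    vertex set that pairwise meet in fewer than [t] points and cover almost
    all [t]-sets.  In each of them every [r]-set but one is an edge of [F]; this
    gives ['C(k, r) - 1] edges for ['C(k, t)] covered [t]-sets, which is the
    stated density.  Moreover [F] has the [r]-sets that meet a bounded core in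
    two points or more, and those that consist of a core point and an uncovered
    [t]-set.  The hypergraph [H] has two complete blocks on [k] vertices, a hub
    playing the role of the core, and one edge joining the first block to the
    hub.  Its copies restore the missing edge of every block (second block of
    [H]), then produce all edges with one point in the core (joining edge),
    then all remaining edges.

    The packing is an explicit substitute for Rodl's theorem.  Points are pairs
    of a part [i < m] and a label.  For each [k]-set [K] of parts the blocks are
    the graphs over [K] of tuples of polynomials of degree less than [t],
    shifted by a function [v K].  A transversal [t]-set extends to a unique
    tuple of polynomials, whose coefficients of degree [t - 1] add up to its
    colour.  Shifts are chosen so that a [t]-set over [S] in a block over [K]
    has a colour that determines [K] among the [k]-sets containing [S].  This
    makes the blocks of different [K] meet in fewer than [t] points, while
    almost every colour is used. *)

(** * Polynomial codes with prescribed colours *)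

Section Code.
Import GRing.Theory.
Local Open Scope ring_scope.
Variables (R : comUnitRingType) (m t : nat).
Hypothesis small_unit :
  forall d : nat, (0 < d < m.*2)%N -> (d%:R : R) \is a GRing.unit.

Local Notation Idx := {set 'I_m}.
Local Notation Word := {ffun Idx -> 'rV[R]_t}.
Local Notation Label := {ffun Idx -> R}.

(* The dependence on [e] makes the products of inverses of node differences
   over distinct [t]-sets linearly independent as functions of [e]. *)
Definition node (e : Idx) (i : 'I_m) : R := (i.*2 + (i \in e))%:R.

Definition colour (f : Word) : R := \sum_e (rVpoly (f e))`_t.-1.

Definition word_val (f : Word) (i : 'I_m) : Label :=
  [ffun e => (rVpoly (f e)).[node e i]].

Lemma natr_sub_unit (a b : nat) :
  a != b -> (a < m.*2)%N -> (b < m.*2)%N -> (a%:R - b%:R : R) \is a GRing.unit.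
Proof.
wlog lt_ba : a b / (b < a)%N => [IH|] nab a_lt b_lt.
  case: (ltngtP b a) => [?|?|eab]; first exact: IH.
    by rewrite -opprB unitrN IH // eq_sym.
  by rewrite eab eqxx in nab.
by rewrite -natrB 1?ltnW // small_unit // subn_gt0 lt_ba /=; lia.
Qed.

Lemma node_sub_unit (e : Idx) (i j : 'I_m) :
  i != j -> node e i - node e j \is a GRing.unit.
Proof.
move=> nij; have nij' : (i : nat) != j by [].
apply: natr_sub_unit; have := ltn_ord i; have := ltn_ord j;
  by case: (i \in e); case: (j \in e); lia.
Qed.

Lemma colourD (f g : Word) : colour (f + g) = colour f + colour g.
Proof.
by rewrite /colour -big_split; apply: eq_bigr => e _; rewrite ffunE linearD coefD.
Qed.

Lemma word_valD (f g : Word) (i : 'I_m) :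
  word_val (f + g) i = word_val f i + word_val g i.
Proof. by apply/ffunP => e; rewrite !ffunE linearD hornerD. Qed.

Lemma word_val0 (i : 'I_m) : word_val 0 i = 0.
Proof. by apply/ffunP => e; rewrite !ffunE linear0 horner0. Qed.

Lemma colour0 : colour 0 = 0.
Proof. by rewrite /colour big1 // => e _; rewrite ffunE linear0 coef0. Qed.

(** For each [e] the difference of the two polynomials has degree below [t] and vanishes at [t]
    nodes with unit differences, so it is zero even though [R] may have zero divisors. *)
Lemma word_val_inj (S : {set 'I_m}) (f g : Word) :
  #|S| = t -> {in S, word_val f =1 word_val g} -> f = g.
Proof.
move=> cS fg; apply/ffunP => e; apply/(can_inj rVpolyK)/eqP.
rewrite -subr_eq0; apply: contraT => nz.
have size_lt := @max_ring_poly_roots R _ [seq node e i | i <- enum S] nz.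
have: (size [seq node e i | i <- enum S] < t)%N; last first.
  by rewrite size_map -cardE cS ltnn.
apply: leq_trans (size_lt _ _) _.
- apply/allP => _ /mapP[i + ->]; rewrite mem_enum => iS.
  have /ffunP/(_ e) := fg i iS; rewrite !ffunE => eqv.
  by rewrite /root hornerD hornerN eqv subrr.
- elim: (enum S) (enum_uniq S) => //= i s IHs /andP[nis us].
  rewrite IHs // andbT; apply/allP => _ /mapP[j js ->].
  rewrite /diff_roots mulrC eqxx /= node_sub_unit //.
  by apply: contraNneq nis => <-.
apply: leq_trans (size_polyD _ _) _.
by rewrite geq_max size_polyN !size_poly.
Qed.

(** Adding [v] to the values of a word changes, over every [S], the word interpolating them by [g],
    hence its colour by [a S]: a single shift prescribes the colour offsets on all [S] at once. *)
Definition interpolates_colours (v : 'I_m -> Label) (a : {set 'I_m} -> R) :=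
  forall S : {set 'I_m}, #|S| = t ->
    exists2 g : Word, {in S, forall i, word_val g i = v i} & colour g = a S.

Hypothesis t_gt0 : (0 < t)%N.

Lemma interpolates_colours_delta (S0 : {set 'I_m}) (a : R) : #|S0| = t ->
  exists v, interpolates_colours v (fun S => if S == S0 then a else 0).
Proof.
move=> cS0; have /set0Pn[i0 i0S0] : S0 != set0 by rewrite -card_gt0 cS0.
pose y0 (j : 'I_m) : R := (i0.*2%:R - j.*2%:R)^-1.
pose y1 (j : 'I_m) : R := (i0.*2%:R - j.*2.+1%:R)^-1.
(* [v] is supported at [i0]; signed summation over the subsets [e] of [S0 :\ i0]
   cancels the colour of every [S] that misses a point of [S0]. *)
pose sg (e : Idx) : R :=
  \prod_i (if i \in e then (if i \in S0 :\ i0 then -1 else 0) else 1).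
pose u : R := \prod_(j in S0 :\ i0) (y0 j - y1 j).
have u_unit : u \is a GRing.unit.
  rewrite rpred_prod // => j; rewrite !inE => /andP[ji0 _].
  have nji0 : (j : nat) != i0 by [].
  have := ltn_ord j; have := ltn_ord i0 => i0m jm.
  have U0 : i0.*2%:R - j.*2%:R \is a @GRing.unit R.
    by apply: natr_sub_unit; lia.
  have U1 : i0.*2%:R - j.*2.+1%:R \is a @GRing.unit R.
    by apply: natr_sub_unit; lia.
  (* The denominators differ by 1, so the difference of the reciprocals is, up to sign, their
     product, which is a unit. *)
  have -> : y0 j - y1 j = - (y0 j * y1 j).
    have e1 : i0.*2%:R - j.*2.+1%:R = i0.*2%:R - j.*2%:R - 1 :> R.
      by rewrite -addn1 natrD opprD addrA.
    move: U0 U1 e1; rewrite /y0 /y1; move: (_ - _) (_ - _) => x z Ux Uz ez.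
    apply: (mulrI Ux); apply: (mulIr Uz).
    rewrite mulrBr mulrBl divrr // mul1r mulrN mulrA divrr //.
    by rewrite mul1r mulNr -mulrA !mulVr // mulr1 ez addrC addKr.
  by rewrite unitrN unitrM !unitrV U0.
have sumE (S : {set 'I_m}) : #|S| = t -> i0 \in S ->
    \sum_e sg e * \prod_(j in S :\ i0) (node e i0 - node e j)^-1
      = if S == S0 then u else 0.
  move=> cS i0S.
  (* [P] and [Q] are the factors at [i] for [i] inside and outside [e], so the sum over [e] becomes
     the product of all [P i + Q i]. As [P i0 = 0], only sets [e] without [i0] count, and for them
     [node e i0] is constant. *)
  pose P i : R := (if i \in S0 :\ i0 then -1 else 0) *
              (if i \in S :\ i0 then y1 i else 1).
  pose Q i : R := if i \in S :\ i0 then y0 i else 1.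
  transitivity (\sum_(e in Idx) \prod_i (if i \in e then P i else Q i)).
    apply: eq_bigr => e _; have [i0e|i0e] := boolP (i0 \in e).
      rewrite /sg (bigD1 i0) //= i0e !inE eqxx /= !mul0r.
      by rewrite [RHS](bigD1 i0) //= i0e /P !inE eqxx /= !mul0r.
    rewrite big_mkcond -big_split; apply: eq_bigr => i _ /=.
    rewrite /P /Q; case: ifP => ie; last first.
      by rewrite mul1r; case: ifP => // _; rewrite /node (negPf i0e) ie !addn0.
    by congr (_ * _); case: ifP => // _; rewrite /node (negPf i0e) ie addn0 addn1.
  rewrite -bigA_distr; case: eqP => [eS|/eqP nS].
    rewrite /u [RHS]big_mkcond; apply: eq_bigr => i _; rewrite /P /Q eS.
    by case: ifP => _; rewrite /= ?mul0r ?add0r // mulN1r addrC.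
  (* As [S] and [S0] have the same size, [S] misses a point of [S0]; there the factor is
     [-1 + 1]. *)
  have /subsetPn[j jS0 jS] : ~~ (S0 :\ i0 \subset S :\ i0).
    apply: contra nS => sub; rewrite eq_sym eqEcard cS cS0 leqnn andbT.
    by rewrite -(setD1K i0S0) -(setD1K i0S) setUS.
  by rewrite (bigD1 j) //= /P /Q jS0 (negPf jS) mulr1 addNr mul0r.
pose v (i : 'I_m) : Label := if i == i0 then [ffun e => a * u^-1 * sg e] else 0.
exists v => S cS; have [i0S|i0S] := boolP (i0 \in S); last first.
  exists 0 => [i iS|]; last first.
    by rewrite colour0; case: eqP => // eS; rewrite eS i0S0 in i0S.
  by rewrite word_val0 /v; case: eqP => // ei; rewrite -ei iS in i0S.
(* The interpolating polynomial vanishes at the nodes of [S :\ i0], so it is a multiple of the monic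
   [L e], and the scalar is its contribution to the colour. *)
pose L e : {poly R} := \prod_(j in S :\ i0) ('X - (node e j)%:P).
have cS' : #|S :\ i0| = t.-1 by rewrite -cS (cardsD1 i0 S) i0S.
have sizeL e : size (L e) = t.
  by rewrite /L -big_enum size_prod_XsubC -cardE cS' prednK.
have LE e : (L e)`_t.-1 = 1.
  have /monicP := monic_prod_XsubC (enum (S :\ i0)) predT (node e).
  by rewrite big_enum -/(L e) /lead_coef sizeL.
pose c e := a * u^-1 * sg e * \prod_(j in S :\ i0) (node e i0 - node e j)^-1.
have polyE e : rVpoly (poly_rV (c e *: L e) : 'rV_t) = c e *: L e.
  by rewrite poly_rV_K // (leq_trans (size_scale_leq _ _)) ?sizeL.
exists [ffun e => poly_rV (c e *: L e)] => [i iS|].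
  apply/ffunP => e; rewrite !ffunE polyE hornerZ /v.
  rewrite /L horner_prod; case: eqP => [->|/eqP nii0].
    rewrite ffunE /c -[RHS]mulr1 -[LHS]mulrA; congr (_ * _).
    rewrite -big_split /= big1 // => j.
    rewrite !inE => /andP[ji0 _]; rewrite !hornerE mulVr //.
    by rewrite node_sub_unit // eq_sym.
  rewrite ffunE (bigD1 i) ?inE ?nii0 //= hornerXsubC subrr.
  by rewrite mul0r mulr0.
transitivity (a * u^-1 * (if S == S0 then u else 0)).
  rewrite -sumE // mulr_sumr; apply: eq_bigr => e _.
  by rewrite ffunE polyE coefZ LE mulr1 /c mulrA.
by case: ifP => _; rewrite ?mulr0 // mulrVK.
Qed.

(** Values and colours are additive, so the shifts found for single sets [S0] can be summed. *)
Lemma interpolates_colours_exists (a : {set 'I_m} -> R) :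
  exists v, interpolates_colours v a.
Proof.
suff [v vP] : exists v, interpolates_colours v
    (fun S => \sum_(S0 <- index_enum {set 'I_m} | #|S0| == t)
                (if S == S0 then a S0 else 0)).
  exists v => S cS; have [g gv gc] := vP S cS; exists g => //.
  rewrite gc (bigD1 S) ?cS //= eqxx big1 ?addr0 // => S0.
  by case/andP => _; rewrite eq_sym => /negPf->.
elim: (index_enum _) => [|S1 s [v vP]].
  exists (fun=> 0) => S cS; exists 0; last by rewrite big_nil colour0.
  by move=> i _; rewrite word_val0.
have [cS1|cS1] := eqVneq #|S1| t; last first.
  exists v => S cS; have [g gv gc] := vP S cS; exists g => //.
  by rewrite big_cons (negPf cS1).
have [w wP] := interpolates_colours_delta (a S1) cS1.
exists (fun i => w i + v i) => S cS.
have [g gv gc] := vP S cS; have [h hw hc] := wP S cS.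
exists (h + g) => [i iS|]; first by rewrite word_valD gv // hw.
by rewrite big_cons cS1 eqxx colourD hc gc.
Qed.

End Code.

(** * Near-perfect packings *)

Lemma card_supersets (T : finType) (S : {set T}) (k : nat) : #|S| <= k ->
  #|[set K : {set T} | #|K| == k & S \subset K]| = 'C(#|T| - #|S|, k - #|S|).
Proof.
move=> leSk; have -> : #|T| - #|S| = #|~: S| by rewrite [RHS]cardsCs setCK.
rewrite -cards_draws.
rewrite -[RHS](card_in_imset (f := fun A => A :|: S)); last first.
  move=> A A'; rewrite !inE => /andP[sA _] /andP[sA' _] eqA.
  have D (X : {set T}) : X \subset ~: S -> (X :|: S) :\: S = X.
    by move=> sX; rewrite setDUl setDv setU0; apply/setDidPl; rewrite disjoints_subset.
  by rewrite -(D A sA) -(D A' sA') eqA.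
congr #|pred_of_set _|; apply/setP => K; rewrite inE.
apply/andP/imsetP => [[/eqP cK sK]|[A]].
  exists (K :\: S); last by rewrite setUC -[LHS](setID K S) (setIidPr sK).
  by rewrite inE setDE subsetIr -setDE cardsD (setIidPr sK) cK eqxx.
rewrite inE => /andP[sA /eqP cA] ->; rewrite subsetUr; split=> //.
rewrite cardsU cA; have -> : A :&: S = set0.
  by apply/eqP; rewrite setI_eq0 disjoints_subset.
by rewrite cards0 subn0 subnK.
Qed.

Section Partite.
Import GRing.Theory.
Local Open Scope ring_scope.
Variables (m t s : nat).
Hypotheses (t_gt0 : (0 < t)%N) (s_gt1 : (1 < s)%N).

Local Notation Word := {ffun {set 'I_m} -> 'rV['Z_s]_t}.

(** Translation by a word of colour [c] carries the fibre of 0 onto the fibre of [c], so all fibres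
    of [colour] are equally large. *)
Lemma card_colour (Z : {set 'Z_s}) :
  (s * #|[set f : Word | colour f \in Z]| = #|Z| * s ^ (t * 2 ^ m))%N.
Proof.
pose N0 := #|[set f : Word | colour f == 0]|.
have fib c : #|[set f : Word | colour f == c]| = N0.
  pose fc : Word := [ffun e => if e == finset.set0 then poly_rV (c *: 'X^(t.-1)) else 0].
  have fcE : colour fc = c.
    rewrite /colour (bigD1 finset.set0) //= big1 ?addr0 => [|e ne].
      rewrite ffunE eqxx poly_rV_K ?coefZ ?coefXn ?eqxx ?mulr1 //.
      by rewrite (leq_trans (size_scale_leq _ _)) // size_polyXn prednK.
    by rewrite ffunE (negPf ne) linear0 coef0.
  rewrite /N0 -[RHS](card_imset _ (addIr fc)).
  congr #|pred_of_set _|; apply/setP => f; rewrite inE.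
  apply/eqP/imsetP => [cf|[g]]; last first.
    by rewrite inE => /eqP cg ->; rewrite colourD cg fcE add0r.
  exists (f - fc); last by rewrite subrK.
  rewrite inE; apply/eqP/(addIr (colour fc)).
  by rewrite -colourD subrK cf fcE add0r.
have fibs (Y : {set 'Z_s}) : #|[set f : Word | colour f \in Y]| = (#|Y| * N0)%N.
  rewrite -sum1_card (partition_big (@colour _ m t) (mem Y)) /=; last first.
    by move=> f; rewrite inE.
  rewrite -sum_nat_const; apply: eq_bigr => c cY; rewrite -(fib c) -sum1_card.
  apply: eq_bigl => f; rewrite !inE andbC.
  by case: eqP => // ->.
have card_Z : #|'Z_s| = s by rewrite card_ord; case: (s) s_gt1 => [|[]].
have := fibs [set: 'Z_s].
rewrite (eq_card (B := predT)) => [|f]; last by rewrite !inE.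
rewrite cardsT card_Z card_ffun card_mx card_Z mul1n -expnM.
have -> : #|{set 'I_m}| = (2 ^ m)%N.
  by rewrite -cardsT -powersetT card_powerset cardsT card_ord.
by rewrite fibs => ->; rewrite mulnCA.
Qed.

Lemma partite_packing (k : nat) : (t <= k)%N -> (k <= m)%N ->
  (forall d : nat, (0 < d < m.*2)%N -> coprime s d) ->
  exists B : {set {set 'I_m * {ffun {set 'I_m} -> 'Z_s}}},
  [/\ forall b, b \in B -> #|b| = k,
      forall b b', b \in B -> b' \in B -> (t <= #|b :&: b'|)%N -> b = b' &
      (s * #|B| = 'C(m, k) * (s %/ 'C(m - t, k - t)) * s ^ (t * 2 ^ m))%N].
Proof.
move=> le_tk le_km cop; set D := 'C(m - t, _).
have D_gt0 : (0 < D)%N by rewrite bin_gt0; apply: leq_sub2r.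
have small d : (0 < d < m.*2)%N -> (d%:R : 'Z_s) \is a GRing.unit.
  by move=> /cop; rewrite unitZpE.
pose sup (S : {set 'I_m}) := [set K : {set 'I_m} | #|K| == k & S \subset K].
have card_sup (S : {set 'I_m}) : #|S| = t -> #|sup S| = D.
  by move=> cS; rewrite card_supersets cS ?card_ord.
(* The offset is the rank of [K] among the [k]-sets containing [S]; it is below [D] and identifies
   [K] once [S] is known. *)
pose a (K S : {set 'I_m}) := index K (enum (sup S)).
have a_lt K (S : {set 'I_m}) : #|S| = t -> K \in sup S -> (a K S < D)%N.
  by move=> cS KS; rewrite -(card_sup S cS) cardE index_mem mem_enum.
have [v vP] := fin_all_exists (fun K =>
  interpolates_colours_exists small t_gt0 (fun S => (a K S)%:R)).
pose W := (s %/ D)%N.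
(* Words are restricted to colours [D * w] with [w < W]. Adding an offset below [D] never wraps
   around modulo [s], so the offset can be read off modulo [D]. *)
pose Z : {set 'Z_s} := [set (D * w)%:R | w : 'I_W].
have natr_inj (x y : nat) : (x < s)%N -> (y < s)%N -> x%:R = y%:R :> 'Z_s -> x = y.
  move=> xs ys /(congr1 (@nat_of_ord _)).
  by rewrite !val_Zp_nat // !modn_small.
have DW_lt (w : 'I_W) (x : nat) : (x < D)%N -> (D * w + x < s)%N.
  move=> xD; have := leq_trunc_div s D; have := ltn_ord w; rewrite -/W; nia.
have card_Z : #|Z| = W.
  rewrite card_imset ?card_ord // => w w' /natr_inj eww; apply/ord_inj.
  apply/eqP; rewrite -(eqn_pmul2l D_gt0); apply/eqP/eww.
    by rewrite -[X in (X < _)%N]addn0 DW_lt.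
  by rewrite -[X in (X < _)%N]addn0 DW_lt.
pose J := finset.setX [set K : {set 'I_m} | #|K| == k] [set f : Word | colour f \in Z].
pose blk (x : {set 'I_m} * Word) :=
  [set (i, word_val x.2 i + v x.1 i) | i in x.1].
have card_blk x : #|blk x| = #|x.1| by rewrite card_imset // => i j [].
have blk_inj x y : x \in J -> y \in J -> (t <= #|blk x :&: blk y|)%N -> x = y.
  case: x y => [K f] [K' f']; rewrite !inE /=.
  move=> /andP[/eqP cK cf] /andP[/eqP cK' cf'] t_le.
  pose common := [set i in K :&: K' | word_val f i + v K i == word_val f' i + v K' i].
  have : (t <= #|common|)%N.
    apply: leq_trans t_le _.
    rewrite -(card_imset common (f := fun i => (i, word_val f i + v K i))).
      apply/subset_leq_card/subsetP => p; rewrite inE.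
      case/andP => /imsetP[i iK ->] /imsetP[j jK' [eij e]]; subst j.
      by apply: imset_f; rewrite !inE iK jK' e eqxx.
    by move=> i j [].
  rewrite -bin_gt0 -cards_draws card_gt0 => /set0Pn[S].
  rewrite inE => /andP[/subsetP sS /eqP cS].
  have sSK : S \subset K by apply/subsetP => i /sS; rewrite !inE => /andP[/andP[]].
  have sSK' : S \subset K' by apply/subsetP => i /sS; rewrite !inE => /andP[/andP[]].
  have agree i : i \in S -> word_val f i + v K i = word_val f' i + v K' i.
    by move/sS; rewrite !inE => /andP[_ /eqP].
  have [g gv gc] := vP K S cS; have [g' gv' gc'] := vP K' S cS.
  (* Both words interpolate the common points of the two blocks over [S]. *)
  have efg : f + g = f' + g'.
    apply: (word_val_inj small cS) => i iS.
    by rewrite !word_valD gv // gv' // agree.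
  have : colour (f + g) = colour (f' + g') by rewrite efg.
  rewrite !colourD gc gc'.
  have /imsetP[w _ ->] := cf; have /imsetP[w' _ ->] := cf'.
  have KS : K \in sup S by rewrite inE cK eqxx.
  have KS' : K' \in sup S by rewrite inE cK' eqxx.
  have aK := a_lt K S cS KS; have aK' := a_lt K' S cS KS'.
  rewrite -!natrD => /natr_inj; rewrite !DW_lt // => /(_ isT isT) eDw.
  have ea : a K S = a K' S.
    have := congr1 (modn^~ D) eDw.
    by rewrite ![(D * _)%N]mulnC !modnMDl !modn_small.
  have eK : K = K'.
    by rewrite -(nth_index K (_ : K \in enum (sup S))) ?mem_enum // -/(a K S) ea
         nth_index ?mem_enum.
  move: agree; rewrite -eK => agree; congr pair.
  by apply: (word_val_inj small cS) => i /agree /addIr.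
exists [set blk x | x in J]; split.
- move=> _ /imsetP[x + ->]; rewrite !inE card_blk.
  by case/andP => /eqP.
- by move=> _ _ /imsetP[x xJ ->] /imsetP[y yJ ->] /(blk_inj x y xJ yJ) ->.
rewrite card_in_imset; last first.
  move=> x y xJ yJ eb; apply: blk_inj; rewrite // -eb setIid card_blk.
  by move: xJ; rewrite !inE => /andP[/eqP->].
by rewrite cardsX card_draws card_ord mulnCA card_colour card_Z mulnA.
Qed.

End Partite.

(** * Estimates for the density of the packing *)

Lemma expnD_leq (s N A : nat) : (s + N) ^ A <= s ^ A + A * N * (s + N) ^ A.-1.
Proof.
elim: A => [|A IHA]; first by rewrite !expn0 leq_addr.
rewrite expnS mulnDl /= (leq_trans (leq_add (leq_mul (leqnn s) IHA) (leqnn _))) //.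
rewrite mulnDr -expnS -addnA leq_add2l mulSn mulnDl addnC leq_add2l.
case: A {IHA} => [|A] /=; first by rewrite !mul0n muln0.
by rewrite expnS mulnCA leq_mul // leq_mul // leq_addr.
Qed.

Lemma ffact_leq_exp (m t : nat) : m ^_ t <= m ^ t.
Proof.
rewrite ffact_prod -[in leqRHS](card_ord t) -prod_nat_const.
by apply: leq_prod => i _; apply: leq_subr.
Qed.

(** Passing from the power to the falling factorial loses at most a fraction [t ^ 2 / m]; the factor
    [m] keeps this in integers. *)
Lemma ffact_geq (m t : nat) : m ^ t.+1 <= m * m ^_ t + t ^ 2 * m ^ t.
Proof.
elim: t => [|t IHt]; first by rewrite expn1 ffactn0 muln1 leq_addr.
have ffact_le := ffact_leq_exp m t.
have {}IHt := leq_mul (leqnn m) IHt.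
rewrite -expnS in IHt; apply: leq_trans IHt _; rewrite ffactnSr [m ^ t.+1]expnS -!mulnn.
have m_le : m <= (m - t) + t by lia.
have := leq_mul (leqnn (m * m ^_ t)) m_le; have := leq_mul (leqnn (t * m)) ffact_le.
move: (m ^_ t) (m ^ t) => x y; nia.
Qed.

(* The bounds [Q.-1 * x <= Q * y] below say that [y] is at least [(1 - 1 / Q) x]. *)
Lemma expnD_near (Q s N A : nat) :
  Q * (A * N) <= s + N -> Q.-1 * (s + N) ^ A <= Q * s ^ A.
Proof.
case: Q => [|Q]; first by rewrite mul0n.
case: A => [|A]; first by rewrite !expn0 !muln1 leqnSn.
move=> le_s; have := leq_mul (leqnn Q.+1) (expnD_leq s N A.+1).
have := leq_mul le_s (leqnn ((s + N) ^ A)); rewrite [(s + N) ^ A.+1]expnS /=.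
move: (A.+1 * N) (s ^ A.+1) ((s + N) ^ A) (s + N); clear; nia.
Qed.

Lemma ffact_near (Q m t : nat) :
  0 < m -> Q * t ^ 2 <= m -> Q.-1 * m ^ t <= Q * m ^_ t.
Proof.
move=> m_gt0; rewrite -[_ <= Q * _](leq_pmul2l m_gt0).
have := ffact_geq m t; rewrite expnS.
by move: (m ^ t) (m ^_ t) (t ^ 2) => x y z; clear; case: Q => //= Q; nia.
Qed.

Lemma divn_near (Q s D : nat) :
  0 < D -> Q * D <= s -> Q.-1 * s <= Q * (D * (s %/ D)).
Proof.
move=> D_gt0; have := divn_eq s D; have := ltn_pmod s D_gt0.
by move: (s %/ D) (s %% D) => x y; clear; case: Q => //= Q; nia.
Qed.

(** Bernoulli's inequality for [1 - 1 / (3 * q)] cubed, which merges three losses into one. *)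
Lemma cube_near (q x y : nat) :
  0 < q -> (3 * q).-1 ^ 3 * x <= (3 * q) ^ 3 * y -> q.-1 * x <= q * y.
Proof.
case: q => // q _; have -> : (3 * q.+1).-1 = 3 * q + 2 by lia.
move=> le_xy; have pos : 0 < 27 * q.+1 ^ 2 by rewrite muln_gt0 expn_gt0.
have le_q : 27 * q.+1 ^ 2 * q <= (3 * q + 2) ^ 3 by rewrite !expnS !expn0; nia.
rewrite -(leq_pmul2l pos) mulnA; apply: leq_trans (leq_mul le_q (leqnn x)) _.
by apply: leq_trans le_xy _; rewrite eq_leq //; ring.
Qed.

(** Turns a lower bound on the number [z] of covered sets into an upper bound on the uncovered ones;
    [c] will be their total number and [f] the factorial of [t]. *)
Lemma sub_near (q f c x z : nat) : 0 < q -> 0 < f ->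
  q.-1 * x <= q * (f * z) -> c * f <= x -> q * (c - z) <= x.
Proof.
case: q => // q _ f_gt0 /= le1 le2.
apply: leq_trans (_ : f * (q.+1 * (c - z)) <= x); first by rewrite leq_pmull.
have -> : f * (q.+1 * (c - z)) = q.+1 * (c * f) - q.+1 * (f * z).
  by rewrite mulnCA -mulnBr mulnBr [f * c]mulnC.
by have := leq_mul (leqnn q.+1) le2; lia.
Qed.

Lemma mul_bin_bin (m k t : nat) : t <= k -> k <= m ->
  'C(m, k) * 'C(k, t) = 'C(m, t) * 'C(m - t, k - t).
Proof.
move=> tk km; have tm := leq_trans tk km.
have ktm : k - t <= m - t by apply: leq_sub2r.
have e1 := bin_fact km; have e2 := bin_fact tk; have e3 := bin_fact tm.
have e4 := bin_fact ktm.
have e5 : m - t - (k - t) = m - k by lia.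
rewrite e5 in e4.
have pos : 0 < t`! * (k - t)`! * (m - k)`! by rewrite !muln_gt0 !fact_gt0.
apply/eqP; rewrite -(eqn_pmul2r pos); apply/eqP.
transitivity m`!; first by rewrite -e1 -e2; ring.
by rewrite -e3 -e4; ring.
Qed.

(** A partite packing is embedded into [X]. Three losses occur, each a fraction of at most [1 / Q]:
    points of [X] outside the image, [t]-sets that are not transversal, and the rounding in
    [s %/ D]. *)
Lemma near_perfect_packing (t k q : nat) : 0 < t -> t <= k ->
  exists n0, forall (T : finType) (X : {set T}), n0 <= #|X| ->
  exists B : {set {set T}},
  [/\ forall b, b \in B -> b \subset X /\ #|b| = k,
      forall b b', b \in B -> b' \in B -> t <= #|b :&: b'| -> b = b' &
      q * ('C(#|X|, t) - #|B| * 'C(k, t)) <= #|X| ^ t].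
Proof.
(* A large [m] makes non-transversal [t]-sets rare; [N] makes every [s = N * j + 1] coprime to all
   positive numbers below [m.*2]; [E] is the number of coordinates of a label; [j0] makes [s] large
   against [D] and the gap [N]. *)
move=> t_gt0 tk; pose Q := 3 * q; pose m := k + Q * t ^ 2.
pose N := (m.*2)`!; pose E := 2 ^ m; pose D := 'C(m - t, k - t).
pose j0 := (Q * D + Q * (E * t) * N).+1.
have m_gt0 : 0 < m by lia.
have km : k <= m by rewrite leq_addr.
have N_gt0 : 0 < N by rewrite fact_gt0.
have E_gt0 : 0 < E by rewrite expn_gt0.
exists (m * (N * j0 + 1) ^ E) => T X; set n := #|X| => n_ge.
(* The largest [j] whose [m * s ^ E] points fit into [X] is used; its maximality gives
   [n <= m * (s + N) ^ E]. *)
pose P j := m * (N * j + 1) ^ E <= n.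
have Pub j : P j -> j <= n.
  move=> Pj; apply: leq_trans Pj; have : N * j + 1 <= (N * j + 1) ^ E.
    by rewrite -[leqLHS]expn1 leq_pexp2l // addn1.
  nia.
have [j Pj jmax] := ex_maxnP (ex_intro P j0 n_ge) Pub.
have j_ge : j0 <= j by apply: jmax.
pose s := N * j + 1.
have s_gt1 : 1 < s by rewrite /s /j0 in j_ge *; nia.
have cop d : 0 < d < m.*2 -> coprime s d.
  move=> /andP[d_gt0 d_lt]; have dN : d %| N by apply: dvdn_fact; lia.
  rewrite coprime_sym /s; apply: (coprime_dvdl dN).
  by rewrite /coprime mulnC gcdnMDl gcdn1.
have [B [cB iB sB]] := partite_packing t_gt0 s_gt1 tk km cop.
pose pt := ('I_m * {ffun {set 'I_m} -> 'Z_s})%type.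
have card_pt : #|{: pt}| = m * s ^ E.
  rewrite card_prod card_ord card_ffun card_ord.
  have -> : #|{set 'I_m}| = E by rewrite -cardsT -powersetT card_powerset cardsT card_ord.
  by case: (s) s_gt1 => [|[]].
have le_pt : #|{: pt}| <= #|X| by rewrite card_pt.
pose h (p : pt) : T := enum_val (widen_ord le_pt (enum_rank p)).
have h_inj : injective h.
  by move=> p p' /enum_val_inj/(congr1 val)/= /ord_inj/enum_rank_inj.
have card_h (A : {set pt}) : #|h @: A| = #|A| by rewrite card_imset.
exists [set h @: b | b : {set pt} in B]; split.
- move=> _ /imsetP[b bB ->]; rewrite card_h cB //; split=> //.
  by apply/subsetP => _ /imsetP[p _ ->]; apply: enum_valP.
- move=> _ _ /imsetP[b bB ->] /imsetP[b' bB' ->].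
  by rewrite -imsetI ?card_h => [/(iB _ _ bB bB')->|p p' _ _ /h_inj].
rewrite (card_imset _ (imset_inj h_inj)).
have n_lt : n <= m * (s + N) ^ E.
  rewrite ltnW // ltnNge; apply/negP => Pj1; have := jmax j.+1.
  have -> : P j.+1 by rewrite /P; have -> : N * j.+1 + 1 = s + N by rewrite /s; lia.
  by rewrite ltnn => /(_ isT).
have D_gt0 : 0 < D by rewrite bin_gt0; apply: leq_sub2r.
have j0_le : j0 <= s.
  by rewrite (leq_trans j_ge) // /s addn1 ltnW // ltnS leq_pmull.
have QD_le : Q * D <= s by rewrite (leq_trans _ j0_le) // ltnW // ltnS leq_addr.
case: (posnP q) => [->|q_gt0]; first by rewrite mul0n.
have n_le : Q.-1 * n ^ t <= Q * (m ^ t * s ^ (t * E)).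
  have s_le : Q.-1 * (s + N) ^ (t * E) <= Q * s ^ (t * E).
    apply: expnD_near; apply: leq_trans (leq_trans _ j0_le) (leq_addr _ _).
    by rewrite mulnA [t * E]mulnC ltnW // ltnS leq_addl.
  rewrite [leqRHS]mulnCA; apply: leq_trans (leq_mul (leqnn _) s_le).
  rewrite mulnCA leq_mul // mulnC [t * E]mulnC expnM -expnMn mulnC leq_exp2r //.
have m_le : Q.-1 * m ^ t <= Q * m ^_ t by rewrite ffact_near // leq_addl.
have s_le : Q.-1 * s <= Q * (D * (s %/ D)) by apply: divn_near.
set Z := #|B| * 'C(k, t).
(* The number of covered [t]-sets, suitably scaled, is a product with one factor for each of the
   three losses. *)
have sZ : s * (t`! * Z) = m ^_ t * (D * (s %/ D)) * s ^ (t * E).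
  transitivity (t`! * 'C(k, t) * (s * #|B|)); first by rewrite /Z; ring.
  rewrite sB -bin_ffact.
  transitivity (('C(m, k) * 'C(k, t)) * (t`! * (s %/ D)) * s ^ (t * E)).
    by rewrite -/D -/E; ring.
  by rewrite mul_bin_bin // -/D; ring.
have Z_ge : Q.-1 ^ 3 * n ^ t <= Q ^ 3 * (t`! * Z).
  rewrite -(leq_pmul2l (ltnW s_gt1)) [leqRHS]mulnCA sZ.
  have h1 := leq_mul (leqnn Q) (leq_mul (leq_mul m_le s_le) (leqnn (s ^ (t * E)))).
  have h2 := leq_mul (leqnn (Q.-1 ^ 2 * s)) n_le.
  apply: leq_trans (leq_trans _ h2) (leq_trans _ (leq_trans h1 _)).
  - by rewrite eq_leq //; ring.
  - by rewrite eq_leq //; ring.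
  by rewrite eq_leq //; ring.
have {}Z_ge : q.-1 * n ^ t <= q * (t`! * Z) by apply: cube_near Z_ge.
apply: sub_near q_gt0 (fact_gt0 t) Z_ge _.
by rewrite bin_ffact ffact_leq_exp.
Qed.

(** * Weak saturation *)

Lemma exists_subset_card (T : finType) (A : {set T}) (n : nat) :
  n <= #|A| -> exists2 B : {set T}, B \subset A & #|B| = n.
Proof.
rewrite -bin_gt0 -cards_draws card_gt0 => /set0Pn[B].
by rewrite inE => /andP[sB /eqP cB]; exists B.
Qed.

(** Fibres with the same label are enumerated and matched by position. The embeddings of [H] below
    come from this, the labels saying where each vertex goes. *)
Lemma exists_fibrewise_injection (V T : finType) (I : eqType) (p : V -> I) (q : T -> I) :
  (forall v, #|[set u | p u == p v]| <= #|[set w | q w == p v]|) ->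
  exists2 f : V -> T, injective f & forall v, q (f v) = p v.
Proof.
move=> le_pq; have [v0|V0] := pickP V; last first.
  by exists (fun v => False_rect T (elimF idP (V0 v) isT)) => v; have := V0 v.
have /card_gt0P[w0 _] : 0 < #|[set w | q w == p v0]|.
  apply: leq_trans (le_pq v0); rewrite card_gt0; apply/set0Pn.
  by exists v0; rewrite inE.
pose src i := enum [set u | p u == i]; pose dst i := enum [set w | q w == i].
pose f v := nth w0 (dst (p v)) (index v (src (p v))).
have v_src v : v \in src (p v) by rewrite mem_enum inE.
have lt_dst v : index v (src (p v)) < size (dst (p v)).
  by apply: leq_trans (_ : size (src (p v)) <= _); rewrite ?index_mem // -!cardE.
have qf v : q (f v) = p v.
  by apply/eqP; have := mem_nth w0 (lt_dst v); rewrite mem_enum inE.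
exists f => // u v fuv; have puv : p u = p v by rewrite -!qf fuv.
have := fuv; rewrite /f puv => /eqP; rewrite nth_uniq ?enum_uniq // => [/eqP eI|].
  by rewrite -(nth_index u (v_src v)) -eI nth_index // -puv.
by rewrite -puv.
Qed.

Lemma has_copy_throughI (V T : finType) (H : {set {set V}}) (G : {set {set T}})
    (e : {set T}) (f : V -> T) :
  injective f -> (forall x, x \in H -> f @: x \in G) ->
  (exists2 x, x \in H & f @: x = e) -> has_copy_through H G e.
Proof.
move=> f_inj fG [x xH fx]; apply/existsP; exists (finfun f).
have fE (y : {set V}) : finfun f @: y = f @: y by apply: eq_imset => v; rewrite ffunE.
apply/and3P; split.
- by apply/injectiveP => u v; rewrite !ffunE => /f_inj.
- by apply/subsetP => _ /imsetP[y yH ->]; rewrite fE fG.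
by apply/imsetP; exists x; rewrite // fE fx.
Qed.

(** Induction on the number of missing edges: it is enough to add one edge at an arbitrary stage
    [G], without fixing the order in advance. *)
Lemma weakly_saturated_greedy (V T : finType) (r : nat) (H : {set {set V}})
    (F : {set {set T}}) : uniform r F ->
  (forall G : {set {set T}}, F \subset G -> G \proper complete T r ->
     exists2 e, e \in complete T r :\: G & has_copy_through H (e |: G) e) ->
  weakly_saturated r H F.
Proof.
move=> uF step; rewrite /weakly_saturated uF /=.
suff ext (G : {set {set T}}) : F \subset G -> G \subset complete T r ->
    exists2 s, perm_eq s (enum (complete T r :\: G)) &
      forall i, i < size s ->
        has_copy_through H (G :|: [set:: take i.+1 s]) (nth set0 s i).
  have [s ps hs] := ext F (subxx _) uF; apply/hasP; exists s.
    by rewrite mem_permutations.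
  by apply/forallP => i; apply: hs.
have [n] := ubnP #|complete T r :\: G|; elim: n G => // n IHn G lt_n sFG sG.
have [->|nG] := eqVneq G (complete T r).
  by exists [::]; rewrite ?setDv ?enum_set0.
have pG : G \proper complete T r by rewrite properEneq nG.
have [e eG copy_e] := step G sFG pG.
have [eC eNG] : e \in complete T r /\ e \notin G by move: eG; rewrite inE => /andP[].
have GeE : complete T r :\: (e |: G) = (complete T r :\: G) :\ e.
  by apply/setP => x; rewrite !inE negb_or andbA.
have [||//|s ps hs] := IHn (e |: G).
- by rewrite GeE; move: lt_n; rewrite (cardsD1 e) eG.
- exact: subset_trans sFG (subsetUr _ _).
- by rewrite subUset sub1set eC.
exists (e :: s) => [|[|i] lt_i] /=.
- have es : e \notin s by rewrite (perm_mem ps) mem_enum GeE !inE eqxx.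
  apply: uniq_perm; rewrite ?enum_uniq //= ?es ?(perm_uniq ps) ?enum_uniq //.
  move=> x; rewrite inE (perm_mem ps) !mem_enum GeE !inE.
  by have [->|] := eqVneq x e; rewrite ?eNG ?eC //=; move: eC; rewrite inE => ->.
- by rewrite take0 set_seq1 setUC.
have := hs i lt_i; congr (has_copy_through H _ _).
by rewrite set_cons setUA [e |: G]setUC.
Qed.

Lemma card_link (T : finType) (r : nat) (H : {set {set T}}) (U : {set T}) :
  0 < r -> uniform r H -> #|U| = r.-1 ->
  #|link H U| = #|[set x | (x \notin U) && (x |: U \in H)]|.
Proof.
move=> r_gt0 /subsetP uH cU; rewrite -[RHS](card_imset _ set1_inj).
apply: eq_card => y; apply/imsetP/imsetP => [[e]|[x]].
  rewrite inE => /andP[eH sUe] ->.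
  have /eqP/cards1P[x ex] : #|e :\: U| = 1.
    by rewrite cardsD (setIidPr sUe) cU; move: (uH e eH); rewrite inE => /eqP->; lia.
  exists x => //; have xU : x \in e :\: U by rewrite ex set11.
  rewrite inE; move: (xU); rewrite inE => /andP[-> _] /=.
  by rewrite -ex setUC -{1}(setIidPr sUe) setID.
rewrite inE => /andP[xU xH] ->; exists (x |: U); first by rewrite inE xH subsetUr.
by rewrite setDUl setDv setU0; apply/esym/setDidPl; rewrite disjoints1.
Qed.

(** * The hypergraph [H] and weak saturation of the host *)

Section Gadget.
Variables (V : finType) (r k delta : nat) (A1 A2 hub U0 : {set V}) (tip : V).
Hypotheses (r_gt1 : 1 < r) (delta_gt0 : 0 < delta) (k_def : k = r.-1 + delta).
Hypotheses (A12 : [disjoint A1 & A2]) (A1h : [disjoint A1 & hub])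
  (A2h : [disjoint A2 & hub]).
Hypotheses (cA1 : #|A1| = k) (cA2 : #|A2| = k) (ch : #|hub| = k.+1).
Hypotheses (sU0 : U0 \subset A1) (cU0 : #|U0| = r.-1) (tip_hub : tip \in hub).

Definition gadget : {set {set V}} :=
  [set e : {set V} | (#|e| == r) &&
     [|| e \subset A1, e \subset A2, 1 < #|e :&: hub| | e == tip |: U0]].

Lemma gadget_uniform : uniform r gadget.
Proof. by apply/subsetP => e; rewrite !inE => /andP[]. Qed.

Let rK : r.-1.+1 = r.
Proof. by rewrite prednK // ltnW. Qed.

Let kK : k - r.-1 = delta.
Proof. by rewrite k_def addKn. Qed.

Let tipA1 : tip \notin A1.
Proof. by move/disjointFr: A1h => A1hF; apply/negP => /A1hF; rewrite tip_hub. Qed.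

Let tipA2 : tip \notin A2.
Proof. by move/disjointFr: A2h => A2hF; apply/negP => /A2hF; rewrite tip_hub. Qed.

Let tipU0 : tip \notin U0.
Proof. by apply: contra tipA1; apply/subsetP. Qed.

Let ce0 : #|tip |: U0| = r.
Proof. by rewrite cardsU1 tipU0 cU0 add1n. Qed.

(** A set with non-empty link that meets the hub extends by every other hub vertex. One that avoids
    the hub lies in [A1] or [A2] and extends by the rest of that block, giving at least
    [k - (r - 1) = delta]; inside [A2] there are no further extensions. *)
Lemma gadget_delta_star : delta_star r gadget = delta.
Proof.
have r_gt0 := ltnW r_gt1.
have e0H : tip |: U0 \in gadget by rewrite inE ce0 !eqxx !orbT.
have Hn0 : gadget != set0 by apply/set0Pn; exists (tip |: U0).
have [[U [cU nU eU]] lower] := delta_starP r_gt0 gadget_uniform Hn0.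
have blockU (A W : {set V}) :
    #|A| = k -> W \subset A -> #|W| = r.-1 -> #|A :\: W| = delta.
  by move=> cA sW cW; rewrite cardsD (setIidPr sW) cA cW.
have cU1 (x : V) (W : {set V}) : #|W| = r.-1 -> x \notin W -> #|x |: W| == r.
  by move=> cW xW; rewrite cardsU1 xW cW add1n rK.
apply/eqP; rewrite eqn_leq; apply/andP; split.
  have [W sW cW] : exists2 W : {set V}, W \subset A2 & #|W| = r.-1.
    by apply: exists_subset_card; rewrite cA2 k_def leq_addr.
  have /set0Pn[w wW] : W != set0 by rewrite -card_gt0 cW -ltnS rK.
  have wA2 := subsetP sW w wW.
  have WE : #|link gadget W| = delta.
    rewrite (card_link r_gt0 gadget_uniform cW) -(blockU A2 W) //.
    apply: eq_card => x; rewrite !inE; case: (boolP (x \in W)) => //= xW.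
    rewrite cU1 //=; apply/idP/idP => [|xA2]; last first.
      by rewrite !subUset !sub1set xA2 sW orbT.
    rewrite !subUset !sub1set => /or4P[/andP[_ sW1]|/andP[]//|h2|/eqP e0].
    - by have := disjointFr A12 (subsetP sW1 w wW); rewrite wA2.
    - have: #|(x |: W) :&: hub| <= 1.
        rewrite -(cards1 x); apply/subset_leq_card/subsetP => y.
        rewrite !inE => /andP[/orP[//|yW] yh].
        by have := disjointFr A2h (subsetP sW y yW); rewrite yh.
      by rewrite leqNgt h2.
    have : w \in tip |: U0 by rewrite -e0 !inE wW orbT.
    rewrite !inE => /predU1P[ew|wU0]; first by have := tipA2; rewrite -ew wA2.
    by have := disjointFr A12 (subsetP sU0 w wU0); rewrite wA2.
  by rewrite -WE lower // WE -lt0n.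
rewrite eU; move: nU; rewrite (card_link r_gt0 gadget_uniform cU) cards_eq0 => /set0Pn[x].
rewrite !inE => /and3P[xU _ xUH].
have viaA (A : {set V}) : #|A| = k -> U \subset A ->
    (forall e : {set V}, #|e| = r -> e \subset A -> e \in gadget) ->
    delta <= #|[set x | (x \notin U) && (x |: U \in gadget)]|.
  move=> cA sUA AH; rewrite -(blockU A U) //; apply/subset_leq_card/subsetP => y.
  rewrite in_setD => /andP[yU yA]; rewrite in_set yU AH //.
    exact/eqP/cU1.
  by rewrite subUset sub1set yA.
have [Uh|/set0Pn[y]] := eqVneq (U :&: hub) set0; last first.
  rewrite inE => /andP[yU yh]; have: delta <= #|hub :\: U|.
    rewrite cardsD ch -kK leq_sub // -cU.
    exact: subset_leq_card (subsetIr _ _).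
  move/leq_trans; apply; apply/subset_leq_card/subsetP => z; rewrite in_setD.
  case/andP => zU zh; rewrite 2!in_set zU cU1 //=; apply/or4P/Or43.
  rewrite (cardD1 y) (cardD1 z) !inE yU yh zh eqxx orbT /= andbT.
  by case: eqP => // ezy; rewrite ezy yU in zU.
case/or4P: xUH => [||h2|/eqP e0].
- rewrite subUset => /andP[_ sU]; apply: (viaA A1) => // e ce se.
  by rewrite inE ce eqxx se.
- rewrite subUset => /andP[_ sU]; apply: (viaA A2) => // e ce se.
  by rewrite inE ce eqxx se orbT.
- have: #|(x |: U) :&: hub| <= 1; last by rewrite leqNgt h2.
  rewrite setIUl Uh setU0 -(cards1 x); apply: subset_leq_card; exact: subsetIl.
apply: (viaA A1) => // [|e ce se]; last by rewrite inE ce eqxx se.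
apply/subsetP => y yU; have : y \in tip |: U0 by rewrite -e0 !inE yU orbT.
rewrite !inE => /predU1P[ey|]; last exact: subsetP.
by have : y \in U :&: hub; [rewrite inE yU ey tip_hub | rewrite Uh inE].
Qed.

(* [C] is the core, [B] the packing, and [mis b] the [r]-set left out of [b]. *)
Section Host.
Variables (T : finType) (C : {set T}) (B : {set {set T}}) (mis : {set T} -> {set T}).
Hypothesis cC : #|V| <= #|C|.
Hypothesis B_out : forall b, b \in B -> [disjoint b & C].
Hypothesis B_card : forall b, b \in B -> #|b| = k.
Hypothesis mis_sub : forall b, b \in B -> mis b \subset b.
Hypothesis mis_card : forall b, b \in B -> #|mis b| = r.

Definition host_core : {set {set T}} := [set e in complete T r | 1 < #|e :&: C|].

Definition host_blocks : {set {set T}} :=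
  \bigcup_(b in B) [set e in complete T r | (e \subset b) && (e != mis b)].

Definition host_uncovered : {set {set T}} :=
  [set e in complete T r | (#|e :&: C| == 1) && ~~ [exists b in B, e :\: C \subset b]].

Definition host : {set {set T}} := host_core :|: host_blocks :|: host_uncovered.

Lemma host_uniform : uniform r host.
Proof.
rewrite /uniform !subUset; apply/andP; split; first (apply/andP; split).
- by apply/subsetP => e; rewrite inE => /andP[].
- by apply/bigcupsP => b _; apply/subsetP => e; rewrite inE => /andP[].
by apply/subsetP => e; rewrite inE => /andP[].
Qed.

Lemma exists_placement (X : {set V}) (Y : {set T}) :
  #|X| <= #|Y| -> [disjoint Y & C] ->
  exists f : V -> T, [/\ injective f, forall v, v \in X -> f v \in Y &
                         forall v, v \notin X -> f v \in C].
Proof.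
move=> leXY YC.
pose p v := if v \in X then 0 else 1.
pose q w := if w \in Y then 0 else if w \in C then 1 else 2.
have [v|f f_inj qf] := @exists_fibrewise_injection V T nat p q.
  rewrite {2 3}/p; case: ifP => vX.
    apply: leq_trans (leq_trans leXY _); apply/subset_leq_card/subsetP => u.
      by rewrite inE /p; case: ifP.
    by move=> uY; rewrite inE /q uY.
  apply: leq_trans (max_card _) (leq_trans cC _).
  apply/subset_leq_card/subsetP => u uC; rewrite inE /q uC.
  by rewrite (disjointFl YC uC).
exists f; split=> // v vX; have := qf v; rewrite /p /q.
  by rewrite vX; case: ifP => // _; case: ifP.
by rewrite (negPf vX); case: ifP => // _; case: ifP.
Qed.

Lemma host_saturated : weakly_saturated r gadget host.
Proof.
apply: weakly_saturated_greedy host_uniform _ => G sFG pG.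
have core_G (f : V -> T) (x Y : {set V}) : injective f -> #|x| = r ->
    Y \subset x -> 1 < #|Y| -> (forall v, v \in Y -> f v \in C) -> f @: x \in G.
  move=> f_inj cx sYx cY fY; apply/(subsetP sFG).
  rewrite !inE card_imset // cx eqxx /= -(card_imset Y f_inj) in cY *.
  rewrite (leq_trans cY) // subset_leq_card //; apply/subsetP => _ /imsetP[v vY ->].
  by rewrite inE fY // imset_f // (subsetP sYx).
have hub_G (f : V -> T) (x : {set V}) : injective f -> #|x| = r ->
    1 < #|x :&: hub| -> (forall v, v \in hub -> f v \in C) -> f @: x \in G.
  move=> f_inj cx x_hub fh; apply: (core_G f x (x :&: hub)) => //.
    exact: subsetIl.
  by move=> v; rewrite inE => /andP[_ /fh].
have full_G (f : V -> T) (x : {set V}) : injective f -> #|x| = r ->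
    (forall v, v \in x -> f v \in C) -> f @: x \in G.
  by move=> f_inj cx fx; apply: (core_G f x x); rewrite ?cx.
(* First stage: some [mis b] is missing. [A2] goes onto [b] and the rest into the core, so every
   edge of [H] not inside [A2] gets at least two core points. *)
have [/exists_inP[b bB mis_G]|all_mis] := boolP [exists b in B, mis b \notin G].
  have [f [f_inj fA2 fC]] : exists f : V -> T, [/\ injective f,
      forall v, v \in A2 -> f v \in b & forall v, v \notin A2 -> f v \in C].
    by apply: exists_placement; rewrite ?B_out // cA2 B_card.
  have fA2E : f @: A2 = b.
    apply/eqP; rewrite eqEcard card_imset // cA2 B_card // leqnn andbT.
    by apply/subsetP => _ /imsetP[v vA2 ->]; apply: fA2.
  exists (mis b); first by rewrite !inE mis_G mis_card ?eqxx.
  apply: (has_copy_throughI f_inj) => [x|].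
    rewrite inE => /andP[/eqP cx /or4P[sx|sx|x_hub|/eqP ex]]; rewrite in_setU1.
    - rewrite full_G ?orbT // => v /(subsetP sx) vA1.
      by rewrite fC // (disjointFr A12 vA1).
    - case: eqP => //= /eqP n_mis; apply/(subsetP sFG)/setUP; left; apply/setUP; right.
      apply/bigcupP; exists b; rewrite // !inE card_imset // cx eqxx n_mis andbT /=.
      by rewrite -fA2E imsetS.
    - rewrite hub_G ?orbT // => v vh; rewrite fC //.
      by rewrite (disjointFl A2h vh).
    rewrite full_G ?orbT // => v; rewrite ex !inE => /predU1P[->|vU0]; rewrite fC //.
    by rewrite (disjointFr A12 (subsetP sU0 v vU0)).
  have fx : f @: (A2 :&: f @^-1: mis b) = mis b.
    apply/setP => w; apply/imsetP/idP => [[v]|wm].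
      by rewrite !inE => /andP[_ fv] ->.
    have : w \in f @: A2 by rewrite fA2E (subsetP (mis_sub bB)).
    by case/imsetP => v vA2 ew; exists v; rewrite // !inE vA2 -ew.
  exists (A2 :&: f @^-1: mis b) => //.
  by rewrite inE -(card_imset _ f_inj) fx mis_card // eqxx subsetIl orbT.
have block_G (b e : {set T}) : b \in B -> e \subset b -> #|e| = r -> e \in G.
  move=> bB eb ce; have [->|n_mis] := eqVneq e (mis b).
    by apply: contraNT all_mis => ?; apply/exists_inP; exists b.
  apply/(subsetP sFG)/setUP; left; apply/setUP; right.
  by apply/bigcupP; exists b; rewrite // !inE ce eqxx eb.
(* Second stage: the blocks are complete. A missing edge that meets the core does so in one point
   [c], and its remainder [U] lies in some block [b]; the joining edge is placed on it, with [A1] on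
   [b]. *)
have [/existsP[e /andP[eG eC]]|all_C] :=
    boolP [exists e in complete T r :\: G, e :&: C != set0].
  have [e_nG ce] : e \notin G /\ #|e| = r by move: eG; rewrite !inE => /andP[? /eqP].
  have cap1 : #|e :&: C| = 1.
    apply/eqP; rewrite eqn_leq card_gt0 eC andbT leqNgt; apply: contra e_nG => lt1.
    by apply/(subsetP sFG); rewrite !inE ce eqxx lt1.
  have /exists_inP[b bB sUb] : [exists b in B, e :\: C \subset b].
    apply: contraNT e_nG => n_cov; apply/(subsetP sFG).
    by apply/setUP; right; rewrite !inE ce eqxx cap1 eqxx.
  have /cards1P[c ec] : #|e :&: C| == 1 by rewrite cap1.
  set U := e :\: C in sUb.
  have cC' : c \in C.
    by have : c \in e :&: C; [rewrite ec set11 | rewrite inE => /andP[]].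
  have eE : e = c |: U by rewrite -ec setID.
  have cU : #|U| = r.-1 by rewrite cardsD ce cap1 subn1.
  have bC := B_out bB.
  have UC w : w \in U -> (w \in C) = false by rewrite inE => /andP[/negPf].
  have cb : c \in b = false by rewrite (disjointFl bC cC').
  have cNU : c \in U = false by rewrite inE cC'.
  pose p v := if v \in U0 then 0 else if v \in A1 then 1 else if v == tip then 2 else 3.
  pose q w := if w \in U then 0 else if w \in b then 1 else if w == c then 2
              else if w \in C then 3 else 4.
  have [v|f f_inj qf] := @exists_fibrewise_injection V T nat p q.
    have p0 : [set u | p u == 0] = U0.
      by apply/setP => u; rewrite inE /p; do 3 (case: ifP => //).
    have q0 : [set w | q w == 0] = U.
      by apply/setP => u; rewrite inE /q; do 4 (case: ifP => //).
    have p1 : [set u | p u == 1] = A1 :\: U0.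
      by apply/setP => u; rewrite !inE /p; do 3 (case: ifP => //).
    have q1 : [set w | q w == 1] = b :\: U.
      by apply/setP => u; rewrite in_set in_setD /q; do 4 (case: ifP => //).
    have p2 : [set u | p u == 2] \subset [set tip].
      by apply/subsetP => u; rewrite !inE /p; do 3 (case: ifP => //).
    have q2 : [set c] \subset [set w | q w == 2].
      by apply/subsetP => u; rewrite inE => /eqP->; rewrite inE /q cNU cb eqxx.
    have p3 : [set u | p u == 3] \subset ~: [set tip].
      by apply/subsetP => u; rewrite !inE /p; do 3 (case: ifP => //).
    have q3 : C :\ c \subset [set w | q w == 3].
      apply/subsetP => u; rewrite in_setD1 inE /q => /andP[/negPf-> uC].
      by rewrite (disjointFl bC uC) uC; case: ifP => // /UC; rewrite uC.
    have : p v \in [:: 0; 1; 2; 3] by rewrite /p; do 3 (case: ifP => //).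
    rewrite !inE => /or4P[] /eqP->.
    - by rewrite p0 q0 cU0 cU.
    - by rewrite p1 q1 !cardsD (setIidPr sU0) (setIidPr sUb) cA1 cU0 cU B_card.
    - apply: leq_trans (subset_leq_card p2) (leq_trans _ (subset_leq_card q2)).
      by rewrite !cards1.
    apply: leq_trans (subset_leq_card p3) (leq_trans _ (subset_leq_card q3)).
    by rewrite cardsCs setCK cards1 leq_subLR; have := cC; rewrite (cardsD1 c C) cC'.
  have fU0 v : v \in U0 -> f v \in U.
    move=> vU0; have := qf v; rewrite /p vU0 /q; do 4 (case: ifP => //).
  have fA1 v : v \in A1 -> f v \in b.
    move=> vA1; have [/fU0/(subsetP sUb)//|vU0] := boolP (v \in U0).
    by have := qf v; rewrite /p (negPf vU0) vA1 /q; do 4 (case: ifP => //).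
  have f_tip : f tip = c.
    have := qf tip; rewrite /p (negPf tipU0) (negPf tipA1) eqxx /q.
    by do 3 (case: ifP => //); [move=> /eqP | case: ifP].
  have fC v : v \notin A1 -> f v \in C.
    move=> vA1; have [->|v_tip] := eqVneq v tip; first by rewrite f_tip.
    have vU0 : v \notin U0 by apply: contra vA1; apply/subsetP.
    have := qf v; rewrite /p (negPf vU0) (negPf vA1) (negPf v_tip) /q.
    by do 4 (case: ifP => //).
  have fe0 : f @: (tip |: U0) = e.
    apply/eqP; rewrite eqEcard card_imset // ce0 ce leqnn andbT eE.
    apply/subsetP => _ /imsetP[v + ->]; rewrite !inE => /predU1P[->|/fU0].
      by rewrite f_tip eqxx.
    by rewrite inE => ->; rewrite orbT.
  exists e => //; apply: (has_copy_throughI f_inj) => [x|]; last first.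
    by exists (tip |: U0) => //; rewrite inE ce0 !eqxx !orbT.
  rewrite inE => /andP[/eqP cx /or4P[sx|sx|x_hub|/eqP ->]]; rewrite in_setU1.
  - rewrite (block_G b) ?orbT // ?card_imset //.
    by apply/subsetP => _ /imsetP[v /(subsetP sx) /fA1 + ->].
  - rewrite full_G ?orbT // => v /(subsetP sx) vA2.
    by rewrite fC // (disjointFl A12 vA2).
  - by rewrite hub_G ?orbT // => v vh; rewrite fC // (disjointFl A1h vh).
  by rewrite fe0 eqxx.
have meet_G (e : {set T}) : #|e| = r -> e :&: C != set0 -> e \in G.
  move=> ce eC; apply: contraNT all_C => e_nG; apply/existsP; exists e.
  by rewrite !inE e_nG ce eqxx.
have /properP[_ [e e_compl e_nG]] := pG.
have ce : #|e| = r by move: e_compl; rewrite inE => /eqP.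
have eC : [disjoint e & C].
  by rewrite -setI_eq0; apply: contraNT e_nG => /(meet_G e ce).
(* Last stage: [e] avoids the core. The joining edge goes onto [e]; every other edge of [H] has a
   vertex outside it, hence a core point, and is already present. *)
have [f [f_inj fe0 fC]] : exists f : V -> T, [/\ injective f,
    forall v, v \in tip |: U0 -> f v \in e & forall v, v \notin tip |: U0 -> f v \in C].
  by apply: exists_placement; rewrite // ce0 ce.
have fe0E : f @: (tip |: U0) = e.
  apply/eqP; rewrite eqEcard card_imset // ce0 ce leqnn andbT.
  by apply/subsetP => _ /imsetP[v /fe0 + ->].
exists e; first by rewrite inE e_nG.
apply: (has_copy_throughI f_inj) => [x|]; last first.
  by exists (tip |: U0) => //; rewrite inE ce0 !eqxx !orbT.
rewrite inE => /andP[/eqP cx _]; rewrite in_setU1.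
have [->|nx] := eqVneq x (tip |: U0); first by rewrite fe0E eqxx.
rewrite meet_G ?orbT ?card_imset //.
have /subsetPn[v vx v_nX] : ~~ (x \subset tip |: U0).
  by apply: contra nx => sx; rewrite eqEcard sx ce0 cx /=.
by apply/set0Pn; exists (f v); rewrite inE imset_f ?fC.
Qed.

End Host.
End Gadget.

(** * Counting the edges of the host and assembling the bound *)

Lemma card_covered (T : finType) (X : {set T}) (B : {set {set T}}) (t k : nat) :
  (forall b, b \in B -> b \subset X /\ #|b| = k) ->
  (forall b b', b \in B -> b' \in B -> t <= #|b :&: b'| -> b = b') ->
  #|[set U : {set T} | [&& U \subset X, #|U| == t & [exists b in B, U \subset b]]]|
    = #|B| * 'C(k, t).
Proof.
move=> Bk Bt; rewrite -sum_nat_const.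
transitivity (\sum_(b in B) \sum_(U : {set T} | (U \subset b) && (#|U| == t)) 1).
  rewrite (exchange_big_dep (fun U : {set T} => [&& U \subset X, #|U| == t &
            [exists b in B, U \subset b]])) /=; last first.
    move=> b U bB /andP[sU ->]; have [sb _] := Bk b bB.
    by rewrite (subset_trans sU sb) /=; apply/exists_inP; exists b.
  rewrite -sum1_card; apply: eq_big => [U|U]; first by rewrite inE.
  rewrite inE => /and3P[_ /eqP cU /exists_inP[b bB sUb]].
  (* Two blocks containing the same [t]-set meet in at least [t] points, so they coincide. *)
  rewrite (big_pred1 b) // => b'; rewrite cU eqxx andbT.
  apply/andP/eqP => [[b'B sUb']|-> //].
  by apply: Bt; rewrite // -cU subset_leq_card // subsetI sUb'.
apply: eq_bigr => b bB; have [_ <-] := Bk b bB; rewrite -cards_draws sum1_card.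
by apply: eq_card => U; rewrite !inE.
Qed.

Section HostCard.
Variables (T : finType) (r k : nat) (C : {set T}) (B : {set {set T}})
  (mis : {set T} -> {set T}).
Hypothesis B_card : forall b, b \in B -> #|b| = k.
Hypothesis mis_sub : forall b, b \in B -> mis b \subset b.
Hypothesis mis_card : forall b, b \in B -> #|mis b| = r.

(** Two core points and [r - 2] further points determine the edge; for a bounded core this is of
    lower order than [n ^ (r - 1)]. *)
Lemma card_host_core : #|host_core r C| <= #|C| ^ 2 * 'C(#|T|, r.-2).
Proof.
pose f (z : T * T * {set T}) := z.1.1 |: (z.1.2 |: z.2).
rewrite -card_draws -mulnn -!cardsX.
apply: leq_trans (leq_imset_card f _); apply/subset_leq_card/subsetP => e.
rewrite !inE => /andP[/eqP ce lt1].
have /card_gt0P[x] := ltnW lt1; rewrite inE => /andP[xe xC].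
have : 0 < #|(e :&: C) :\ x| by move: lt1; rewrite (cardsD1 x) inE xe xC.
case/card_gt0P => y; rewrite !inE => /and3P[nyx ye yC].
have yex : y \in e :\ x by rewrite !inE nyx.
apply/imsetP; exists (x, y, (e :\ x) :\ y); last by rewrite /f /= !setD1K.
rewrite !inE xC yC /=; move: ce; rewrite (cardsD1 x) xe (cardsD1 y) yex => <-.
by rewrite !add1n.
Qed.

Lemma card_host_blocks : #|host_blocks r B mis| <= #|B| * ('C(k, r) - 1).
Proof.
rewrite -sum_nat_const /host_blocks.
apply: (big_ind2 (fun (A : {set {set T}}) n => #|A| <= n)) => [|A m A' n|b bB].
- by rewrite cards0.
- by move=> ? ?; rewrite (leq_trans (leq_card_setU _ _)) // leq_add.
rewrite -(B_card bB) -cards_draws (cardsD1 (mis b)) inE mis_sub // mis_card // eqxx.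
rewrite addKn subset_leq_card //; apply/subsetP => e.
by rewrite !inE => /and3P[-> -> ->].
Qed.

Lemma card_host_uncovered :
  #|host_uncovered r C B| <=
  #|C| * #|[set U : {set T} | [&& U \subset ~: C, #|U| == r.-1 &
                                ~~ [exists b in B, U \subset b]]]|.
Proof.
rewrite -cardsX; pose f (z : T * {set T}) := z.1 |: z.2.
apply: leq_trans (leq_imset_card f _); apply/subset_leq_card/subsetP => e.
rewrite !inE => /and3P[/eqP ce /cards1P[c ec] ncov].
apply/imsetP; exists (c, e :\: C); last by rewrite /f /= -ec setID.
have : c \in e :&: C by rewrite ec set11.
rewrite !inE ncov /= => /andP[_ ->]; rewrite setDE subsetIr -setDE cardsD ec cards1 ce.
by rewrite subn1 eqxx.
Qed.

End HostCard.

(** Here [x] will be the number of blocks, each contributing all its [r]-sets but one, and [y] the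
    error from core and uncovered edges; the little-o is expressed by the arbitrary [q]. *)
Lemma wsat_uniform_ge2 (r delta : nat) : 1 < r -> 0 < delta ->
  exists (V : finType) (H : {set {set V}}),
  [/\ uniform r H, delta_star r H = delta &
    forall q, exists n0, forall n, n0 <= n -> exists x y,
    [/\ x * 'C(r + delta - 1, r - 1) <= 'C(n, r - 1), q * y <= n ^ (r - 1) &
        wsat r n H <= x * ('C(r + delta - 1, r) - 1) + y]].
Proof.
move=> r_gt1 delta_gt0.
have -> : r + delta - 1 = r.-1 + delta by lia.
have -> : r - 1 = r.-1 by lia.
set k := r.-1 + delta; set t := r.-1.
have t_gt0 : 0 < t by rewrite /t; lia.
have tk : t <= k by rewrite leq_addr.
have rk : r <= k by rewrite /k; lia.
pose V := 'I_(k + k + k.+1).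
have [A1 _ cA1] : exists2 A1 : {set V}, A1 \subset setT & #|A1| = k.
  by apply: exists_subset_card; rewrite cardsT card_ord; lia.
have [A2 sA2 cA2] : exists2 A2 : {set V}, A2 \subset ~: A1 & #|A2| = k.
  by apply: exists_subset_card; rewrite cardsCs setCK card_ord cA1; lia.
pose hub := ~: (A1 :|: A2).
have A12 : [disjoint A1 & A2] by rewrite disjoint_sym disjoints_subset.
have ch : #|hub| = k.+1.
  rewrite cardsCs setCK card_ord cardsU cA1 cA2 (disjoint_setI0 A12) cards0; lia.
have A1h : [disjoint A1 & hub] by rewrite disjoints_subset setCK subsetUl.
have A2h : [disjoint A2 & hub] by rewrite disjoints_subset setCK subsetUr.
have [U0 sU0 cU0] : exists2 U0 : {set V}, U0 \subset A1 & #|U0| = r.-1.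
  by apply: exists_subset_card; rewrite cA1.
have /card_gt0P[tip tip_hub] : 0 < #|hub| by rewrite ch.
exists V, (gadget r A1 A2 hub U0 tip); split.
- exact: gadget_uniform.
- exact: (@gadget_delta_star V r k delta).
(* Each of the two error terms gets half of the allowance: an uncovered [t]-set yields up to [c]
   edges, whence [q'], and core edges need [n] at least [2 * q * c ^ 2]. *)
move=> q; pose c := #|V|; pose q' := 2 * q * c.
have [n1 packing] := near_perfect_packing q' t_gt0 tk.
exists (n1 + c + 2 * q * c ^ 2) => n n_ge.
have [C _ cC] : exists2 C : {set 'I_n}, C \subset setT & #|C| = c.
  by apply: exists_subset_card; rewrite cardsT card_ord; lia.
have cCC : #|~: C| = n - c by rewrite cardsCs setCK card_ord cC.
have [B [Bk Bt Bq]] : exists B : {set {set 'I_n}},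
    [/\ forall b, b \in B -> b \subset ~: C /\ #|b| = k,
        forall b b', b \in B -> b' \in B -> t <= #|b :&: b'| -> b = b' &
        q' * ('C(#|~: C|, t) - #|B| * 'C(k, t)) <= #|~: C| ^ t].
  by apply: packing; rewrite cCC; lia.
(* Any [r]-subset of [b] will do; since [r <= k], the default is never taken on a block. *)
pose mis (b : {set 'I_n}) :=
  odflt set0 [pick m : {set 'I_n} | (m \subset b) && (#|m| == r)].
have misP b : b \in B -> mis b \subset b /\ #|mis b| = r.
  move=> /Bk[_ cb]; rewrite /mis; case: pickP => [m /andP[sm /eqP cm]|none] //.
  have [m sm cm] : exists2 m : {set 'I_n}, m \subset b & #|m| = r.
    by apply: exists_subset_card; rewrite cb.
  by have := none m; rewrite sm cm eqxx.
have misS b (bB : b \in B) := (misP b bB).1.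
have misC b (bB : b \in B) := (misP b bB).2.
have B_card b (bB : b \in B) := (Bk b bB).2.
have B_out b : b \in B -> [disjoint b & C].
  by move=> bB; rewrite disjoints_subset (Bk b bB).1.
set unc := [set U : {set 'I_n} | [&& U \subset ~: C, #|U| == t &
                                ~~ [exists b in B, U \subset b]]].
have cov := card_covered Bk Bt.
have covU : #|B| * 'C(k, t) + #|unc| = 'C(#|~: C|, t).
  rewrite -cov -cards_draws.
  rewrite -[RHS](cardsID [set U : {set 'I_n} | [exists b in B, U \subset b]]).
  congr (_ + _); apply: eq_card => U; rewrite !inE -?andbA //.
  by rewrite [RHS]andbC -andbA.
exists #|B|, (c ^ 2 * 'C(n, r.-2) + c * #|unc|); split.
- by rewrite (leq_trans (leq_addr #|unc| _)) // covU leq_bin2l // cCC leq_subr.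
- have unc_le : q' * #|unc| <= n ^ t.
    rewrite -covU addKn in Bq; apply: leq_trans Bq _.
    by rewrite leq_exp2r // cCC leq_subr.
  have core_le : 2 * q * c ^ 2 * 'C(n, r.-2) <= n ^ t.
    have -> : t = r.-2.+1 by rewrite /t; lia.
    rewrite [n ^ _]expnS leq_mul //; first by lia.
    apply: leq_trans (ffact_leq_exp _ _).
    by rewrite -bin_ffact leq_pmulr // fact_gt0.
  move: core_le unc_le; rewrite /q'.
  move: ('C(n, _)) #|unc| (n ^ t) (c ^ 2) => x y z w; clear; nia.
have [_ wsat_le] := wsatP r n (gadget r A1 A2 hub U0 tip).
apply: leq_trans (wsat_le (host r C B mis) _) _.
  by apply: (@host_saturated V r k A1 A2 hub U0 tip); rewrite // cC.
rewrite /host; apply: leq_trans (leq_card_setU _ _) _.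
apply: leq_trans (leq_add (leq_card_setU _ _) (leqnn _)) _.
rewrite [leqRHS]addnA leq_add //; last first.
  by rewrite -cC; apply: card_host_uncovered.
rewrite addnC leq_add //; first exact: card_host_blocks.
by have := card_host_core r C; rewrite cC card_ord.
Qed.

(** With [H] made of [delta] singletons, any [delta - 1] singleton edges together with any missing
    one form a copy. *)
Lemma wsat_uniform1 (delta : nat) : 0 < delta ->
  exists (V : finType) (H : {set {set V}}),
  [/\ uniform 1 H, delta_star 1 H = delta &
    forall n, delta <= n -> wsat 1 n H <= delta - 1].
Proof.
move=> delta_gt0; exists 'I_delta, (complete 'I_delta 1).
have uni : uniform 1 (complete 'I_delta 1) by apply: subxx.
split=> // [|n n_ge].
  have Hn0 : complete 'I_delta 1 != set0.
    by apply/set0Pn; exists [set Ordinal delta_gt0]; rewrite inE cards1.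
  have [[U [cU _ ->]] _] := delta_starP (ltn0Sn 0) uni Hn0.
  rewrite (card_link _ uni cU) // (cards0_eq cU) -[RHS]card_ord.
  by apply: eq_card => x; rewrite !inE setU0 cards1.
have [X _ cX] : exists2 X : {set 'I_n}, X \subset setT & #|X| = delta - 1.
  by apply: exists_subset_card; rewrite cardsT card_ord; lia.
pose F := [set [set x] | x in X].
have cF : #|F| = delta - 1 by rewrite card_imset //; apply: set1_inj.
have [_ /(_ F)] := wsatP 1 n (complete 'I_delta 1); rewrite cF; apply.
apply: weakly_saturated_greedy => [|G sFG /properP[_ [e e1 eG]]].
  by apply/subsetP => _ /imsetP[x _ ->]; rewrite inE cards1.
exists e; first by rewrite inE eG.
move: e1 eG; rewrite inE => /cards1P[x ->] xG {e}.
have xX : x \notin X.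
  by apply: contra xG => xX; apply/(subsetP sFG)/imset_f.
(* The single label [true] forces the image into [x |: X]; this set has exactly [delta] points, so
   the image is all of it and contains [x]. *)
have [v|f f_inj fq] := @exists_fibrewise_injection 'I_delta 'I_n bool
    predT (fun w => w \in x |: X).
  apply: leq_trans (max_card _) _; rewrite card_ord.
  rewrite (eq_card (B := x |: X)) => [|w]; last by rewrite inE eqb_id.
  by rewrite cardsU1 xX cX; lia.
have f_x : x \in f @: setT.
  suff -> : f @: setT = x |: X by rewrite !inE eqxx.
  apply/eqP; rewrite eqEcard card_imset // cardsT card_ord cardsU1 xX cX.
  apply/andP; split; last by lia.
  by apply/subsetP => _ /imsetP[v _ ->]; rewrite fq.
apply: (has_copy_throughI f_inj) => [e|]; last first.
  have /imsetP[v _ xE] := f_x; exists [set v]; first by rewrite inE cards1.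
  by rewrite imset_set1 -xE.
rewrite inE => /cards1P[v ->]; rewrite imset_set1.
have : f v \in x |: X by rewrite fq.
rewrite !inE => /predU1P[->|fX]; first by rewrite eqxx.
by rewrite (subsetP sFG) ?orbT // imset_f.
Qed.

Lemma wsat_near_bound (r delta : nat) : (1 <= r) -> (1 <= delta) ->
  exists (V : finType) (H : {set {set V}}),
  [/\ uniform r H, delta_star r H = delta &
    forall q, exists n0, forall n, (n0 <= n) -> exists x y,
    [/\ (x * 'C(r + delta - 1, r - 1) <= 'C(n, r - 1)),
        (q * y <= n ^ (r - 1)) &
        (wsat r n H <= x * ('C(r + delta - 1, r) - 1) + y)]].
Proof.
case: r => [|[|r]] // _ delta_gt0; last exact: wsat_uniform_ge2.
have [V [H [uH dH wH]]] := wsat_uniform1 delta_gt0; exists V, H; split=> // q.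
exists delta => n /wH le_w; exists 1, 0; split; rewrite ?muln0 ?subnn ?bin0 //.
by rewrite addn0 mul1n addKn bin1.
Qed.

(* The asymptotic statement over the reals *)
From mathcomp Require Import all_classical all_reals all_analysis.
Import Order.TTheory GRing.Theory Num.Theory numFieldNormedType.Exports.
Local Open Scope classical_set_scope.
Local Open Scope ring_scope.

Theorem theorem1p9 (R : realType) (r delta : nat) (hr : (1 <= r)%N)
    (hdelta : (1 <= delta)%N) :
  exists (V : finType) (H : {set {set V}}),
    [/\ uniform r H, delta_star r H = delta &
      exists2 g : nat -> R,
        g =o_\oo (fun n : nat => n%:R ^+ (r - 1) : R) &
        forall n : nat,
          (wsat r n H)%:R
            <= (delta%:R / r%:R - 1 / 'C(r + delta - 1, r - 1)%:R)
               * 'C(n, r - 1)%:R + g n].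
Proof.
have [V [H [uH dH wH]]] := wsat_near_bound hr hdelta.
exists V, H; split=> //.
set k := (r + delta - 1)%N; set t := (r - 1)%N; set a : R := _ - _.
have rt : r = t.+1 by rewrite /t subn1 prednK.
have Ckt_gt0 : (0 < 'C(k, t))%N.
  by rewrite bin_gt0 /k /t leq_sub2r // leq_addr.
have Ckr_gt0 : (0 < 'C(k, r))%N by rewrite bin_gt0 /k -addnBA // leq_addr.
(* Since ['C(k, r) / 'C(k, t) = delta / r], the constant [a] is the number of edges per covered
   [t]-set in a block. *)
have aE : a * 'C(k, t)%:R = ('C(k, r) - 1)%:R.
  rewrite natrB // /a mulrBl mul1r mulVf ?pnatr_eq0 -?lt0n //; congr (_ - _).
  have /(congr1 (fun n => n%:R : R)) := mul_bin_left k t.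
  have -> : (k - t = delta)%N by rewrite /k /t; lia.
  rewrite !natrM -rt => e; rewrite mulrAC -e mulrAC mulfV ?mul1r //.
  by rewrite pnatr_eq0 -lt0n.
(* The sign allows the bound on [x * 'C(k, t)] to be multiplied by [a]. *)
have a_ge0 : 0 <= a.
  by rewrite -(pmulr_lge0 _ (_ : 0 < 'C(k, t)%:R)) ?ltr0n // aE ler0n.
(* The positive part of the excess makes the inequality hold for every [n], leaving only the
   little-o claim. *)
pose g (n : nat) : R := Num.max 0 ((wsat r n H)%:R - a * 'C(n, t)%:R).
exists g => [|n]; last by rewrite -lerBlDl le_max lexx orbT.
apply/eqoP => _ /posnumP[e].
pose q := Num.bound (e%:num^-1).
have q_ge : e%:num^-1 <= q%:R by rewrite ltW // archi_boundP.
have [n0 n0P] := wH q; exists n0 => // n /= n_ge.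
have [x [y [le_x le_y le_w]]] := n0P n n_ge.
rewrite [`|g n|]ger0_norm ?le_max ?lexx // normrX normr_nat.
have y_le : y%:R <= e%:num * n%:R ^+ t.
  rewrite mulrC -ler_pdivrMr // -natrX (le_trans _ (_ : (q * y)%:R <= _)) ?ler_nat //.
  by rewrite natrM mulrC ler_wpM2r.
rewrite ge_max mulr_ge0 //=; apply: le_trans y_le.
have : (wsat r n H)%:R <= (x * ('C(k, r) - 1) + y)%:R :> R by rewrite ler_nat.
rewrite lerBlDr natrD natrM -aE => /le_trans; apply.
rewrite addrC lerD2l mulrCA ler_wpM2l //.
by rewrite -natrM ler_nat.
Qed.
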